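(* Let $A\in\mathbb{R}^{d\times d}$ be symmetric and let $b\in\mathbb{R}^d$ with $b\notin\mathrm{Range}(A)$. Let $g$ be the grade of $b$ with respect to $A$. Run the conjugate residual (CR) iteration on $(A,b)$ started at $x_0=0$, and suppose that no unlucky breakdown occurs. Then, for $1\le k\le g$, one has $Ap_{k-1}=0$ if and only if $k=g$. Furthermore, $p_{g-1}\neq0$.
   Context: Krylov subspace: $\mathcal{K}_k(A,b)=\mathrm{Span}\{b,Ab,\dots,A^{k-1}b\}$, $k\ge 1$. The grade of $b$ with respect to $A$ is the positive integer $g$ with $\dim\mathcal{K}_k(A,b)=k$ for $k\le g$ and $\dim\mathcal{K}_k(A,b)=g$ for $k>g$. CR iteration (in exact arithmetic): $x_0=0$, $r_0=p_0=b$, and for $k=1,2,\dots$, as long as the denominators are nonzero: $\alpha_{k-1}=\langle r_{k-1},Ar_{k-1}\rangle/\|Ap_{k-1}\|^2$, $x_k=x_{k-1}+\alpha_{k-1}p_{k-1}$, $r_k=r_{k-1}-\alpha_{k-1}Ap_{k-1}$, $\beta_{k-1}=\langle r_k,Ar_k\rangle/\langle r_{k-1},Ar_{k-1}\rangle$, $p_k=r_k+\beta_{k-1}p_{k-1}$. No unlucky breakdown (for CR): if $A$ is indefinite, then no generated residual $r_{k-1}$ is a zero-curvature direction, i.e. there is no generated nonzero $r_{k-1}\notin\mathrm{Null}(A)$ with $\langle r_{k-1},Ar_{k-1}\rangle=0$. *)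

(* Defs.v *)
From HB Require Import structures.
From mathcomp Require Import all_boot all_order all_algebra.
From mathcomp Require Import reals.
Set Implicit Arguments.
Unset Strict Implicit.
Unset Printing Implicit Defensive.
Import Order.TTheory GRing.Theory Num.Theory.
Local Open Scope ring_scope.

Section ConjugateResidual.
Variables (R : realType) (d : nat).
Implicit Types (A : 'M[R]_d) (b u v : 'cV[R]_d) (g k j : nat).

Definition dot u v : R := (u^T *m v) 0 0.

Definition norm2 u : R := Num.sqrt (dot u u).

Definition in_range A b : Prop := exists x : 'cV[R]_d, A *m x = b.

Definition indefinite A : Prop :=
  (exists u, 0 < dot u (A *m u)) /\ (exists v, dot v (A *m v) < 0).

Definition krylov A b k : {vspace 'cV[R]_d} :=
  <<[seq A ^+ i *m b | i <- iota 0 k]>>%VS.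

Definition is_grade A b g : Prop :=
  [/\ (0 < g)%N,
      forall k, (0 < k <= g)%N -> \dim (krylov A b k) = k
    & forall k, (g < k)%N -> \dim (krylov A b k) = g].

Record cr_state := CRState {
  cr_sol : 'cV[R]_d;
  cr_res : 'cV[R]_d;
  cr_dir : 'cV[R]_d }.

Definition cr_step A (s : cr_state) : cr_state :=
  let: CRState x r p := s in
  let alpha := dot r (A *m r) / norm2 (A *m p) ^+ 2 in
  let x' := x + alpha *: p in
  let r' := r - alpha *: (A *m p) in
  let beta := dot r' (A *m r') / dot r (A *m r) in
  CRState x' r' (r' + beta *: p).

(* Division by zero is total, so [cr A b k] is a term for every [k]; it is an
   actual iterate only under the predicates [dir_generated] and
   [res_generated] below. *)
Definition cr A b k : cr_state := iter k (cr_step A) (CRState 0 b b).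

Definition cr_x A b k : 'cV[R]_d := cr_sol (cr A b k).
Definition cr_r A b k : 'cV[R]_d := cr_res (cr A b k).
Definition cr_p A b k : 'cV[R]_d := cr_dir (cr A b k).

(* p_k is computed: the denominators of alpha_j and beta_j are nonzero for
   all j < k. *)
Definition dir_generated A b k : Prop :=
  forall j, (j < k)%N ->
    norm2 (A *m cr_p A b j) ^+ 2 != 0 /\
    dot (cr_r A b j) (A *m cr_r A b j) != 0.

(* r_{k+1} (and x_{k+1}) needs p_k and alpha_k, but not beta_k. *)
Definition res_generated A b k : Prop :=
  if k is j.+1 then
    dir_generated A b j /\ norm2 (A *m cr_p A b j) ^+ 2 != 0
  else True.

Definition no_unlucky_breakdown A b : Prop :=
  indefinite A ->
  ~ exists k, [/\ res_generated A b k,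
                  cr_r A b k <> 0,
                  A *m cr_r A b k <> 0
                & dot (cr_r A b k) (A *m cr_r A b k) = 0].

End ConjugateResidual.

(* Main.v *)
Require Import Defs.
From mathcomp Require Import all_boot all_order all_algebra.
From mathcomp Require Import reals.
From mathcomp Require Import ring lra.
Import Order.TTheory GRing.Theory Num.Theory.
Local Open Scope ring_scope.
Set Implicit Arguments.
Unset Strict Implicit.
Unset Printing Implicit Defensive.

(** Write K_k for the Krylov space of dimension k, k <= g.  Two facts about
    these spaces drive the proof.  Below the grade, A strictly raises the
    Krylov degree: it maps K_(k+1) \ K_k into K_(k+2) \ K_(k+1)
    ([krylov_level_mul]), so it is injective on K_(g-1) ([krylov_mul_inj]).
    At the grade, A^g b is a combination of b, ..., A^(g-1) b, and the
    coefficient of b must vanish because b is not in the range of A; factoring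
    out A gives a null vector q of A in K_g \ K_(g-1) ([krylov_null_vector]).

    On the CR side, the recurrences give p_k in K_(k+1) \ K_k as long as the
    step lengths are nonzero, while r_k = b - A x_k is never zero since b is
    not in the range.  A nonzero r_k in K_(g-1) is not in the null space, so a
    vanishing curvature <r_k, A r_k> would be an unlucky breakdown: for a
    semidefinite matrix it cannot happen, because a zero-curvature vector
    outside the null space forces indefiniteness ([zero_curvature_indefinite]).
    Hence p_0, ..., p_(g-1) are all computed ([cr_generated]), p_(g-1) is
    nonzero, and A p_k <> 0 for k < g - 1.

    Finally A p_(g-1) = 0.  The vectors A p_j are pairwise orthogonal
    ([cr_orthogonal]) and p_0, ..., p_(g-2) span K_(g-1), so A p_(g-1) is
    orthogonal to A K_(g-1).  Subtracting a multiple of q from p_(g-1) shows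
    that A p_(g-1) also belongs to A K_(g-1), so it is orthogonal to itself. *)

(** * The dot product and zero-curvature vectors *)

Section Dot.
Variables (R : realType) (d : nat).
Implicit Types (A : 'M[R]_d) (u v w : 'cV[R]_d) (a : R).

Lemma dotE u v : dot u v = \sum_i u i 0 * v i 0.
Proof. by rewrite /dot mxE; apply: eq_bigr => i _; rewrite mxE. Qed.

Lemma dotC u v : dot u v = dot v u.
Proof. by rewrite !dotE; apply: eq_bigr => i _; rewrite mulrC. Qed.

Lemma dotDr u v w : dot u (v + w) = dot u v + dot u w.
Proof. by rewrite /dot mulmxDr mxE. Qed.

Lemma dotZr u a v : dot u (a *: v) = a * dot u v.
Proof. by rewrite /dot -scalemxAr mxE. Qed.

Lemma dotBr u v w : dot u (v - w) = dot u v - dot u w.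
Proof. by rewrite -scaleN1r dotDr dotZr mulN1r. Qed.

Lemma dotDl u v w : dot (u + v) w = dot u w + dot v w.
Proof. by rewrite dotC dotDr !(dotC w). Qed.

Lemma dotZl u a v : dot (a *: u) v = a * dot u v.
Proof. by rewrite dotC dotZr dotC. Qed.

Lemma dotBl u v w : dot (u - v) w = dot u w - dot v w.
Proof. by rewrite dotC dotBr !(dotC w). Qed.

Lemma dot0r u : dot u 0 = 0.
Proof. by rewrite /dot mulmx0 mxE. Qed.

Lemma dot_ge0 u : 0 <= dot u u.
Proof. by rewrite dotE; apply: sumr_ge0 => i _; rewrite -expr2 sqr_ge0. Qed.

Lemma dot_eq0 u : (dot u u == 0) = (u == 0).
Proof.
apply/eqP/eqP => [|->]; last exact: dot0r.
rewrite dotE => /psumr_eq0P u0; apply/matrixP => i j; rewrite ord1 mxE.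
apply/eqP; rewrite -sqrf_eq0 expr2 u0 // => k _.
by rewrite -expr2 sqr_ge0.
Qed.

Lemma dot_mul_sym A u v : A^T = A -> dot u (A *m v) = dot (A *m u) v.
Proof. by move=> symA; rewrite /dot trmx_mul symA mulmxA. Qed.

Lemma norm2_sqr u : norm2 u ^+ 2 = dot u u.
Proof. by rewrite /norm2 sqr_sqrtr // dot_ge0. Qed.

(** Moving from v along w = A v changes the curvature by
    2 t <w, w> + t^2 <w, A w>, whose sign is that of t when t is small. *)
Lemma zero_curvature_indefinite A v :
  A^T = A -> dot v (A *m v) = 0 -> A *m v != 0 -> indefinite A.
Proof.
move=> symA v0; set w := A *m v => wN0.
have n_gt0 : 0 < dot w w by rewrite lt0r dot_eq0 wN0 dot_ge0.
have curv t : dot (v + t *: w) (A *m (v + t *: w))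
    = t * (2 * dot w w + t * dot w (A *m w)).
  rewrite mulmxDr -scalemxAr !(dotDl, dotDr, dotZl, dotZr) v0.
  by rewrite (dot_mul_sym v w symA) -/w; ring.
set c := dot w (A *m w) in curv.
set s := dot w w / (`|c| + 1).
have c1_gt0 : 0 < `|c| + 1 by rewrite ltr_wpDl.
have s_gt0 : 0 < s by rewrite divr_gt0.
have sc_lt : `|s * c| < dot w w.
  rewrite normrM (gtr0_norm s_gt0).
  have -> : dot w w = s * (`|c| + 1) by rewrite /s divfK ?gt_eqF.
  by rewrite ltr_pM2l // ltrDl.
move: sc_lt; rewrite ltr_norml => /andP[lo hi].
split; [exists (v + s *: w) | exists (v + (- s) *: w)]; rewrite curv.
  by rewrite mulr_gt0 //; lra.
by rewrite nmulr_rlt0 ?oppr_lt0 //; lra.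
Qed.

End Dot.

(** * Krylov spaces up to the grade *)

Section Krylov.
Variables (R : realType) (d : nat) (A : 'M[R]_d) (b : 'cV[R]_d).
Implicit Types (u v : 'cV[R]_d) (k m g : nat).

(** This lets Krylov spaces grow by induction on k, each step adding one line. *)
Lemma krylovS k : krylov A b k.+1 = (krylov A b k + <[A ^+ k *m b]>)%VS.
Proof. by rewrite /krylov -(addn1 k) iotaD map_cat span_cat /= add0n span_seq1. Qed.

Lemma krylov0 : krylov A b 0 = 0%VS.
Proof. by rewrite /krylov /= span_nil. Qed.

Lemma mul_expmx k v : A ^+ k.+1 *m v = A *m (A ^+ k *m v).
Proof. by rewrite exprS mulmxA. Qed.

Lemma krylov_sub k m : (k <= m)%N -> (krylov A b k <= krylov A b m)%VS.
Proof.
move=> /subnK <-; elim: (m - k)%N => // n IHn.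
by rewrite addSn krylovS (subv_trans IHn) // addvSl.
Qed.

Lemma mem_krylov_pow k : A ^+ k *m b \in krylov A b k.+1.
Proof. by rewrite krylovS (subvP (addvSr _ _)) // memv_line. Qed.

Lemma mem_krylov_start k : b \in krylov A b k.+1.
Proof.
by apply: subvP (@krylov_sub 1 k.+1 _) _ _ => //; have := mem_krylov_pow 0; rewrite expr0 mul1mx.
Qed.

Lemma krylov_mul k v : v \in krylov A b k -> A *m v \in krylov A b k.+1.
Proof.
elim: k v => [|k IHk] v.
  by rewrite krylov0 memv0 => /eqP ->; rewrite mulmx0 mem0v.
rewrite [krylov A b k.+1]krylovS.
case/memv_addP => u /IHk Au [_ /vlineP[c ->] ->].
rewrite mulmxDr -scalemxAr -mul_expmx rpredD ?rpredZ ?mem_krylov_pow //.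
exact: subvP (krylov_sub (leqnSn _)) _ Au.
Qed.

(** The constant term of the polynomial is split off; the rest is divisible
    by A. *)
Lemma krylov_start_decomp k v : v \in krylov A b k.+1 ->
  exists c, exists2 u, u \in krylov A b k & v = c *: b + A *m u.
Proof.
elim: k v => [|k IHk] v; rewrite krylovS => /memv_addP[w].
  rewrite krylov0 memv0 => /eqP-> [_ /vlineP[c ->] ->].
  exists c, 0; rewrite ?mem0v //.
  by rewrite expr0 mul1mx mulmx0 add0r addr0.
case/IHk => a [u uK ->] [_ /vlineP[c ->] ->].
exists a, (u + c *: (A ^+ k *m b)).
  rewrite rpredD ?rpredZ ?mem_krylov_pow //.
  exact: subvP (krylov_sub (leqnSn _)) _ uK.
by rewrite mulmxDr -scalemxAr -mul_expmx addrA.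
Qed.

(** Any vector of exact degree k serves in place of A^k b as the new basis
    vector. *)
Lemma krylov_level_decomp k p v :
    p \in krylov A b k.+1 -> p \notin krylov A b k -> v \in krylov A b k.+1 ->
  exists c, exists2 u, u \in krylov A b k & v = u + c *: p.
Proof.
rewrite krylovS => /memv_addP[p' p'K [_ /vlineP[a ->] ->]] pN.
case/memv_addP => w wK [_ /vlineP[c ->] ->].
have a0 : a != 0 by apply: contra pN => /eqP ->; rewrite scale0r addr0.
exists (c / a), (w - (c / a) *: p'); first by rewrite rpredB ?rpredZ.
by rewrite scalerDr scalerA divfK // addrA subrK.
Qed.

Variable g : nat.
Hypothesis gradeg : is_grade A b g.

Lemma krylov_dim k : (k <= g)%N -> \dim (krylov A b k) = k.
Proof.
case: gradeg => _ dimK _; case: k => [|k] kg; last exact: dimK.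
by rewrite krylov0 dimv0.
Qed.

Lemma krylov_pow_notin k : (k < g)%N -> A ^+ k *m b \notin krylov A b k.
Proof.
move=> kg; apply/negP => Ak.
have/(congr1 (fun U : {vspace 'cV[R]_d} => \dim U)) := krylovS k.
have /addv_idPl -> : (<[A ^+ k *m b]> <= krylov A b k)%VS by [].
rewrite !krylov_dim ?(ltnW kg) // => /eqP.
by rewrite eqn_leq ltnn.
Qed.

(** The leading term c A^k b of v becomes c A^(k+1) b, which is still
    independent of K_(k+1) because k + 1 is below the grade. *)
Lemma krylov_level_mul k v : (k.+1 < g)%N ->
    v \in krylov A b k.+1 -> v \notin krylov A b k ->
  A *m v \notin krylov A b k.+1.
Proof.
move=> kg; rewrite [krylov A b k.+1 in X in X -> _]krylovS.
case/memv_addP => u uK [_ /vlineP[c ->] ->] vN.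
have c0 : c != 0 by apply: contra vN => /eqP ->; rewrite scale0r addr0.
rewrite mulmxDr -scalemxAr -mul_expmx rpredDl ?krylov_mul //.
by rewrite rpredZeq (negPf c0) krylov_pow_notin.
Qed.

(** A nonzero vector has an exact Krylov degree, and A raises it. *)
Lemma krylov_mul_inj v : v \in krylov A b g.-1 -> A *m v = 0 -> v = 0.
Proof.
move=> vK Av0.
have [n le_ng] : exists2 n, (n <= g.-1)%N & v \in krylov A b n by exists g.-1.
elim: n le_ng => [|n IHn] ng vn; first by apply/eqP; rewrite -memv0 -krylov0.
have [/IHn->//|vN] := boolP (v \in krylov A b n); first exact: ltnW.
have : A *m v \notin krylov A b n.+1.
  by apply: krylov_level_mul => //; case: (g) ng.
by rewrite Av0 mem0v.
Qed.

(** Writing A^g b = c b + A u with u in K_(g-1), the vector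
    q = A^(g-1) b - u satisfies A q = c b, so c <> 0 would put b in the range
    of A. *)
Lemma krylov_null_vector : ~ in_range A b ->
  exists q, [/\ q \in krylov A b g, q \notin krylov A b g.-1 & A *m q = 0].
Proof.
move=> bN; have [g_gt0 _ dimK] := gradeg.
have Ag : A ^+ g *m b \in krylov A b g.
  have -> : krylov A b g = krylov A b g.+1.
    apply/eqP; rewrite eqEdim krylov_sub ?leqnSn //.
    by rewrite dimK ?krylov_dim ?leqnn.
  exact: mem_krylov_pow.
case: g g_gt0 krylov_pow_notin Ag => // h _ powN.
case/krylov_start_decomp => c [u uK].
rewrite mul_expmx /= => eqA.
have Aq : A *m (A ^+ h *m b - u) = c *: b by rewrite mulmxBr eqA addrK.
exists (A ^+ h *m b - u); split.
- rewrite rpredB ?mem_krylov_pow //.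
  exact: subvP (krylov_sub (leqnSn _)) _ uK.
- by rewrite /= rpredBr ?powN.
rewrite Aq; have [->|c0] := eqVneq c 0; first by rewrite scale0r.
case: bN; exists (c^-1 *: (A ^+ h *m b - u)).
by rewrite -scalemxAr Aq scalerA mulVf // scale1r.
Qed.

End Krylov.

(** * The conjugate residual recurrences *)

Section CR.
Variables (R : realType) (d : nat) (A : 'M[R]_d) (b : 'cV[R]_d).
Implicit Types (i j k : nat).

Local Notation x := (cr_x A b).
Local Notation r := (cr_r A b).
Local Notation p := (cr_p A b).
Local Notation "<| u , v |>" := (dot u v).

Definition cr_alpha k : R := <|r k, A *m r k|> / <|A *m p k, A *m p k|>.
Definition cr_beta k : R := <|r k.+1, A *m r k.+1|> / <|r k, A *m r k|>.

Lemma cr_xS k : x k.+1 = x k + cr_alpha k *: p k.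
Proof.
rewrite /cr_alpha -norm2_sqr /cr_x /cr_r /cr_p /cr iterS -/(cr A b k).
by case: (cr A b k).
Qed.

Lemma cr_rS k : r k.+1 = r k - cr_alpha k *: (A *m p k).
Proof.
rewrite /cr_alpha -norm2_sqr /cr_r /cr_p /cr iterS -/(cr A b k).
by case: (cr A b k).
Qed.

Lemma cr_pS k : p k.+1 = r k.+1 + cr_beta k *: p k.
Proof.
rewrite /cr_beta /cr_r /cr_p /cr iterS -/(cr A b k).
by case: (cr A b k).
Qed.

Lemma cr_residual k : r k = b - A *m x k.
Proof.
elim: k => [|k IHk]; first by rewrite mulmx0 subr0.
by rewrite cr_rS cr_xS IHk mulmxDr -scalemxAr opprD addrA.
Qed.

Lemma cr_residual_neq0 k : ~ in_range A b -> r k != 0.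
Proof.
move=> bN; apply/eqP => r0; apply: bN; exists (x k).
by apply/esym/eqP; rewrite -subr_eq0 -cr_residual r0.
Qed.

Lemma dir_generated_le j k :
  (j <= k)%N -> dir_generated A b k -> dir_generated A b j.
Proof. by move=> jk gen i ij; apply: gen; apply: leq_trans jk. Qed.

Lemma dir_generated_neq0 j k : dir_generated A b k -> (j < k)%N ->
  <|A *m p j, A *m p j|> != 0 /\ <|r j, A *m r j|> != 0.
Proof. by move=> gen /gen; rewrite norm2_sqr. Qed.

Lemma dir_generatedS k : dir_generated A b k -> A *m p k != 0 ->
  <|r k, A *m r k|> != 0 -> dir_generated A b k.+1.
Proof.
move=> gen ApN0 rhoN0 j; rewrite ltnS leq_eqVlt => /predU1P[->|/gen//].
by rewrite norm2_sqr dot_eq0.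
Qed.

(** Orthogonality of r_k to A p_i and of A p_k to A p_i are propagated
    together: alpha_k is the value that makes r_(k+1) orthogonal to A p_k, and
    beta_k the one that makes A p_(k+1) orthogonal to A p_k, while the older
    relations are inherited because alpha_i A p_i = r_i - r_(i+1). *)
Lemma cr_orthogonal k : A^T = A -> dir_generated A b k ->
  forall i, (i < k)%N -> <|r k, A *m p i|> = 0 /\ <|A *m p k, A *m p i|> = 0.
Proof.
move=> symA; elim: k => // k IHk gen.
have {}IHk := IHk (dir_generated_le (leqnSn k) gen).
have [apN0 rhoN0] := dir_generated_neq0 gen (ltnSn k).
have r_p : <|r k, A *m p k|> = <|r k, A *m r k|>.
  case: k IHk {gen apN0 rhoN0} => // k IHk.
  rewrite [in LHS]cr_pS mulmxDr dotDr -scalemxAr dotZr.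
  by case: (IHk k (ltnSn k)) => -> _; rewrite mulr0 addr0.
have r_orth i : (i <= k)%N -> <|r k.+1, A *m p i|> = 0.
  rewrite leq_eqVlt => /predU1P[->|ik]; rewrite cr_rS dotBl dotZl.
    by rewrite r_p /cr_alpha divfK // subrr.
  by case: (IHk i ik) => -> ->; rewrite mulr0 subrr.
have r_conj i : (i <= k)%N -> <|r k.+1, A *m r i|> = 0.
  case: i => [|i] ik; first exact: (r_orth 0).
  have -> : r i.+1 = p i.+1 - cr_beta i *: p i by rewrite cr_pS addrK.
  rewrite mulmxBr -scalemxAr dotBr dotZr !r_orth ?mulr0 ?subrr //.
  exact: ltnW.
move=> i; rewrite ltnS => ik; split; first exact: r_orth.
have [apiN0 rhoiN0] := dir_generated_neq0 gen ik.
have aN0 : cr_alpha i != 0 by rewrite mulf_neq0 ?invr_eq0.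
have telescope : cr_alpha i * <|A *m r k.+1, A *m p i|>
    = - <|r k.+1, A *m r i.+1|>.
  have -> : <|r k.+1, A *m r i.+1|>
      = <|r k.+1, A *m r i|> - cr_alpha i * <|A *m r k.+1, A *m p i|>.
    by rewrite [r i.+1]cr_rS mulmxBr -scalemxAr dotBr dotZr
               (dot_mul_sym (r k.+1) (A *m p i)).
  by rewrite r_conj // sub0r opprK.
rewrite [p k.+1]cr_pS mulmxDr -scalemxAr dotDl dotZl.
apply: (mulfI aN0); rewrite mulr0 mulrDr telescope.
move: ik; rewrite leq_eqVlt => /predU1P[->|ik].
  by rewrite /cr_beta /cr_alpha; field; apply/andP.
by rewrite r_conj //; case: (IHk i ik) => _ ->; rewrite !mulr0 oppr0 addr0.
Qed.

(** * Behaviour up to the grade *)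

Variable g : nat.
Hypotheses (symA : A^T = A) (bNrange : ~ in_range A b).
Hypotheses (gradeg : is_grade A b g) (lucky : no_unlucky_breakdown A b).

Lemma krylov_mul_neq0 k v : (k.+1 < g)%N -> v \in krylov A b k.+1 ->
  v != 0 -> A *m v != 0.
Proof.
move=> kg vK; apply: contra_neq; apply: (krylov_mul_inj gradeg).
by apply: subvP (krylov_sub _ _ _) _ vK; case: (g) kg.
Qed.

(** The residual r_k counts as generated one half step before p_k. *)
Lemma lucky_curvature_neq0 k :
    dir_generated A b k -> A *m r k != 0 -> <|r k, A *m r k|> != 0.
Proof.
move=> gen ArN0; apply/eqP => rho0.
apply: (lucky (zero_curvature_indefinite symA rho0 ArN0)).
exists k; split=> //; try exact/eqP.
- case: k gen {ArN0 rho0} => //= k gen; split.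
    exact: dir_generated_le (leqnSn k) gen.
  by case: (gen k).
- exact/eqP/cr_residual_neq0.
Qed.

(** Exactness of the Krylov degree of p_k must be carried along with
    generation: it keeps A p_k nonzero, and it passes to p_(k+1) because
    alpha_k does not vanish. *)
Lemma cr_generated k : (k < g)%N ->
  [/\ dir_generated A b k, r k \in krylov A b k.+1,
      p k \in krylov A b k.+1 & p k \notin krylov A b k].
Proof.
elim: k => [|k IHk] kg.
  split=> //; try exact: mem_krylov_start.
  by rewrite krylov0 memv0 (cr_residual_neq0 0).
have [gen rK pK pN] := IHk (ltnW kg).
have pN0 : p k != 0 by apply: contraNneq pN => ->; rewrite mem0v.
have ApN0 := krylov_mul_neq0 kg pK pN0.
have ArN0 := krylov_mul_neq0 kg rK (cr_residual_neq0 k bNrange).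
have rhoN0 := lucky_curvature_neq0 gen ArN0.
have up := subvP (krylov_sub A b (leqnSn k.+1)).
have r'K : r k.+1 \in krylov A b k.+2.
  by rewrite cr_rS rpredB ?rpredZ ?krylov_mul // up.
split=> //; first exact: dir_generatedS.
  by rewrite cr_pS rpredD ?rpredZ // up.
have aN0 : cr_alpha k != 0 by rewrite mulf_neq0 ?invr_eq0 ?dot_eq0.
(* The only term of p_(k+1) outside K_(k+1) is - alpha_k A p_k. *)
rewrite cr_pS cr_rS addrAC rpredDl ?rpredD ?rpredZ // rpredN.
by rewrite rpredZeq (negPf aN0) (krylov_level_mul gradeg).
Qed.

(** The directions p_0, ..., p_(k-1) have exact degrees 0, ..., k-1, hence span
    K_k. *)
Lemma cr_orthogonal_krylov k v : (k < g)%N -> v \in krylov A b k ->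
  <|A *m p k, A *m v|> = 0.
Proof.
move=> kg; have [gen _ _ _] := cr_generated kg.
have orth := cr_orthogonal symA gen.
(* Induction on the dimension n of the space, with p_k fixed. *)
have [n le_nk] : exists2 n, (n <= k)%N & n = k by exists k.
move=> {1}<-; elim: n le_nk v => [|n IHn] nk v.
  by rewrite krylov0 memv0 => /eqP ->; rewrite mulmx0 dot0r.
have ng := ltn_trans nk kg; have [_ _ pK pN] := cr_generated ng.
move=> /(krylov_level_decomp pK pN)[c [u uK ->]].
rewrite mulmxDr -scalemxAr dotDr dotZr IHn ?(ltnW nk) //.
by case: (orth n nk) => _ ->; rewrite mulr0 addr0.
Qed.

Lemma cr_last_dir_null : A *m p g.-1 = 0.
Proof.
have [g_gt0 _ _] := gradeg.
have lt_g : (g.-1 < g)%N by rewrite prednK.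
have [q [qK qN Aq0]] := krylov_null_vector gradeg bNrange.
have [_ _ pK _] := cr_generated lt_g.
have qK' : q \in krylov A b g.-1.+1 by rewrite prednK.
have [c [u uK eq_p]] :=
  krylov_level_decomp qK' qN pK.
have Ap : A *m p g.-1 = A *m u.
  by rewrite eq_p mulmxDr -scalemxAr Aq0 scaler0 addr0.
by apply/eqP; rewrite -dot_eq0 {2}Ap cr_orthogonal_krylov.
Qed.

Lemma cr_dir_neq0 k : (k < g)%N -> p k != 0.
Proof.
by move=> /cr_generated[_ _ _]; apply: contraNneq => ->; rewrite mem0v.
Qed.

End CR.

Theorem lemma3 (R : realType) (d : nat) (A : 'M[R]_d) (b : 'cV[R]_d) (g : nat)
    (symA : A^T = A) (bNrange : ~ in_range A b) (gradeg : is_grade A b g)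
    (lucky : no_unlucky_breakdown A b) :
  (forall k : nat, (1 <= k <= g)%N ->
     dir_generated A b k.-1 /\ (A *m cr_p A b k.-1 = 0 <-> k = g)) /\
  cr_p A b g.-1 <> 0.
Proof.
have [g_gt0 _ _] := gradeg.
split; last by apply/eqP/(@cr_dir_neq0 _ _ _ _ g) => //; rewrite prednK.
move=> [//|k] /= kg.
have [gen _ pK _] := cr_generated symA bNrange gradeg lucky kg.
split=> //; split=> [Ap0|eq_kg]; last first.
  rewrite -[k]/(k.+1.-1) eq_kg.
  exact: cr_last_dir_null.
apply/eqP; rewrite eqn_leq kg leqNgt; apply/negP => lt_kg.
have pN0 := cr_dir_neq0 symA bNrange gradeg lucky kg.
by move/eqP: (krylov_mul_neq0 gradeg lt_kg pK pN0).
Qed.
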